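(* Let $(f_i)_{i=1}^\infty$ be a sequence of maps, each as in the setting below and satisfying condition (i), let $(m_i)_{i=1}^\infty$ be a sequence in $\mathbb N$, and let $(\bar p_i)_{i=1}^\infty$ be such that $\bar p_i\in[0,1]^{g_{f_i}^{m_i}}$ for each $i$. Then \[ \dim_H\Big(\bigcap_{i=1}^\infty\{x: \bar p_i\in A^{f_i,m_i}(x)\}\Big)=\inf_i \dim_H\big(\{x:\bar p_i\in A^{f_i,m_i}(x)\}\big). \]
   Context: Setting: $f\colon[0,1)\to[0,1)$ and $g_f\ge 2$ is an integer such that $[0,1)$ is partitioned into $g_f$ half-open intervals $[a,b)$, enumerated as $[0],\dots,[g_f-1]$, such that on each of them $f$ is monotone and maps onto $[0,1)$, and $|f(x)-f(y)|\ge |x-y|$ for all $x,y$ in the same interval. For a word $x_1\dots x_n$ over $\{0,\dots,g_f-1\}$ the generation-$n$ cylinder is $C_{x_1\dots x_n}=\{x\in[0,1): f^{i-1}(x)\in[x_i],\ i=1,\dots,n\}$; $[0,1)$ is the generation-$0$ cylinder. It is assumed that $|C_{x_1\dots x_n}|\to 0$ as $n\to\infty$ for every $(x_i)\in\{0,\dots,g_f-1\}^{\mathbb N}$, so each $x\in[0,1)$ has a unique coding sequence $(x_i)_{i\ge1}$ (its $f$-expansion). Condition (i) (bounded distortion): there is $K_f>0$ such that for every cylinder $C_{x_1\dots x_n}$ (including $[0,1)$), $|(f^n)'(y)|/|(f^n)'(z)|<K_f$ for all $y,z\in C_{x_1\dots x_n}$; this implies $|C_{x_1\dots x_{n+1}}|/|C_{x_1\dots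 x_n}|>1/(g_fK_f)$ for all sequences and all $n$. Frequencies: for $m\in\mathbb N$ enumerate the $g_f^m$ words of length $m$ as $w_1,\dots,w_{g_f^m}$. For $x$ with $f$-expansion $(x_i)$ and $n>m$ let $\tau^f_w(x,n)=\#\{i\in\{1,\dots,n-m\}: x_i\dots x_{i+m-1}=w\}$. $A^{f,m}(x)$ denotes the set of accumulation points in $[0,1]^{g_f^m}$ of the vectors $\big(\tau^f_{w_j}(x,n)/(n-m)\big)_{j=1}^{g_f^m}$ as $n\to\infty$. *)

(* Defs.v *)
From Stdlib Require Import Reals Lra Lia List Arith.
Import ListNotations.
Open Scope R_scope.

Definition is_glb (A : R -> Prop) (m : R) : Prop :=
  (forall x, A x -> m <= x) /\
  (forall m', (forall x, A x -> m' <= x) -> m' <= m).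

Definition diam_le (U : R -> Prop) (r : R) : Prop :=
  forall x y, U x -> U y -> Rabs (x - y) <= r.

(* H^s(E) = 0 : for every delta>0 the delta-approximating s-dimensional
   Hausdorff measure H^s_delta(E) is 0, i.e. for every eps>0 there is a
   countable cover of E by sets U_k with diam U_k <= r_k <= delta and
   sum_k r_k^s <= eps. *)
Definition hausdorff_null (s : R) (E : R -> Prop) : Prop :=
  forall eps delta, 0 < eps -> 0 < delta ->
  exists (U : nat -> R -> Prop) (r : nat -> R),
    (forall k, 0 < r k <= delta /\ diam_le (U k) (r k)) /\
    (forall x, E x -> exists k, U k x) /\
    (forall n, sum_f_R0 (fun k => Rpower (r k) s) n <= eps).

Definition is_hausdorff_dim (E : R -> Prop) (d : R) : Prop :=
  is_glb (fun s => 0 <= s /\ hausdorff_null s E) d.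

Record emap := MkEmap {
  ef   : R -> R;
  eg   : nat;
  edig : R -> nat;    (* x |-> index j of the interval [j] containing x *)
  elo  : nat -> R;    (* [j] = [elo j, ehi j) *)
  ehi  : nat -> R
}.

Definition unit_int (x : R) : Prop := 0 <= x < 1.

Definition in_piece (M : emap) (j : nat) (x : R) : Prop :=
  elo M j <= x < ehi M j.

Definition cyl (M : emap) (w : nat -> nat) (n : nat) (x : R) : Prop :=
  unit_int x /\ forall k, (k < n)%nat -> edig M (Nat.iter k (ef M) x) = w k.

Definition interior (A : R -> Prop) (y : R) : Prop :=
  exists e, 0 < e /\ forall z, Rabs (z - y) < e -> A z.

Definition is_expanding_map (M : emap) : Prop :=
  let f := ef M in let g := eg M in
  (2 <= g)%nat /\
  (forall x, unit_int x -> unit_int (f x)) /\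
  (forall j, (j < g)%nat -> 0 <= elo M j < ehi M j /\ ehi M j <= 1) /\
  (forall x, unit_int x ->
     (edig M x < g)%nat /\
     (forall j, (j < g)%nat -> (edig M x = j <-> in_piece M j x))) /\
  (forall j, (j < g)%nat ->
     (forall x y, in_piece M j x -> in_piece M j y -> x <= y -> f x <= f y) \/
     (forall x y, in_piece M j x -> in_piece M j y -> x <= y -> f y <= f x)) /\
  (forall j, (j < g)%nat -> forall y, unit_int y ->
     exists x, in_piece M j x /\ f x = y) /\
  (forall j, (j < g)%nat -> forall x y, in_piece M j x -> in_piece M j y ->
     Rabs (x - y) <= Rabs (f x - f y)) /\
  (forall s : nat -> nat, (forall k, (s k < g)%nat) ->
     forall eps, 0 < eps -> exists N, forall n, (N <= n)%nat ->
       diam_le (cyl M s n) eps).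

(* condition (i): bounded distortion (derivatives of f^n taken at interior
   points of the cylinder, where f^n is a composition of single branches) *)
Definition bounded_distortion (M : emap) : Prop :=
  exists K, 0 < K /\
  forall (n : nat) (w : nat -> nat),
    (forall y, interior (cyl M w n) y ->
       exists dy, derivable_pt_lim (Nat.iter n (ef M)) y dy) /\
    (forall y z dy dz,
       interior (cyl M w n) y -> interior (cyl M w n) z ->
       derivable_pt_lim (Nat.iter n (ef M)) y dy ->
       derivable_pt_lim (Nat.iter n (ef M)) z dz ->
       Rabs dy < K * Rabs dz).

(* k-th digit (0-indexed): x_{k+1} = index of interval containing f^k(x) *)
Definition digit (M : emap) (k : nat) (x : R) : nat :=
  edig M (Nat.iter k (ef M) x).

Definition block (M : emap) (m k : nat) (x : R) : list nat :=
  map (fun j => digit M (k + j) x) (seq 0 m).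

Definition tau (M : emap) (m : nat) (w : list nat) (x : R) (n : nat) : nat :=
  length (filter (fun k => if list_eq_dec Nat.eq_dec (block M m k x) w
                           then true else false) (seq 0 (n - m))).

Definition valid_word (g m : nat) (w : list nat) : Prop :=
  length w = m /\ Forall (fun a => (a < g)%nat) w.

Definition in_accum (M : emap) (m : nat) (p : list nat -> R) (x : R) : Prop :=
  forall eps, 0 < eps -> forall N : nat,
    exists n : nat, (N <= n)%nat /\ (m < n)%nat /\
      forall w, valid_word (eg M) m w ->
        Rabs (INR (tau M m w x n) / INR (n - m) - p w) < eps.

Definition freq_set (M : emap) (m : nat) (p : list nat -> R) (x : R) : Prop :=
  unit_int x /\ in_accum M m p x.

(* Main.v *)
Require Import Defs.
From Stdlib Require Import Reals List Lra Lia Arith.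
From Stdlib Require Import Classical ClassicalEpsilon Cantor.
Import ListNotations.
Open Scope R_scope.

(** Monotonicity of Hausdorff measure gives one inequality. For the other, let
    [t < s < inf dim E_i]. Each [E_i] is invariant under changing finitely many
    digits, so bounded distortion gives [E_i] an [s]-content of at least [c_i
    |I|^s] in every interval [I], and membership in [E_i] is a countable
    conjunction of conditions, each implied by membership in suitable arbitrarily
    small cylinders. Given a cover [U_k] with [sum r_k^t] small, call [sum r_k^t]
    over the [U_k] meeting [I] the weight of [I]. If the weight of [I] is at most
    [(q_i |I|)^t], then some cylinder inside [I] that realises the next condition
    is again as light as required for the map that comes after, because otherwise
    the heavy cylinders and the [U_k] themselves would cover [E_i] in [I] too
    cheaply; here [t < s] absorbs all constants, since the cylinders may be taken
    small. The nested intervals obtained in this way shrink to a point of every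
    [E_i], and no [U_k] contains it since the weights tend to 0. *)

Lemma functional_choice {A B : Type} (P : A -> B -> Prop) :
  (forall x, exists y, P x y) -> exists f, forall x, P x (f x).
Proof.
  intros H. exists (fun x => proj1_sig (constructive_indefinite_description _ (H x))).
  intros x. apply proj2_sig.
Qed.

(** * Finite sums over lists *)

Definition lsum {T : Type} (f : T -> R) (l : list T) : R :=
  fold_right (fun x acc => f x + acc) 0 l.

Lemma lsum_le {T} (f g : T -> R) l :
  (forall x, In x l -> f x <= g x) -> lsum f l <= lsum g l.
Proof.
  induction l as [|x l IH]; simpl; intros H; [lra|].
  assert (f x <= g x) by auto. assert (lsum f l <= lsum g l) by auto. lra.
Qed.

Lemma lsum_nonneg {T} (f : T -> R) l : (forall x, 0 <= f x) -> 0 <= lsum f l.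
Proof.
  intros H; induction l as [|x l IH]; simpl; [lra|]. specialize (H x); lra.
Qed.

Lemma lsum_scal {T} c (f : T -> R) l : lsum (fun x => c * f x) l = c * lsum f l.
Proof. induction l as [|x l IH]; simpl; [|rewrite IH]; ring. Qed.

Lemma lsum_plus {T} (f g : T -> R) l :
  lsum (fun x => f x + g x) l = lsum f l + lsum g l.
Proof. induction l as [|x l IH]; simpl; [|rewrite IH]; ring. Qed.

Lemma lsum_app {T} (f : T -> R) l l' : lsum f (l ++ l') = lsum f l + lsum f l'.
Proof. induction l as [|x l IH]; simpl; [|rewrite IH]; ring. Qed.

Lemma lsum_zero {T} (f : T -> R) l : (forall x, In x l -> f x = 0) -> lsum f l = 0.
Proof.
  induction l as [|x l IH]; simpl; intros H; [reflexivity|].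
  rewrite H, IH by auto. ring.
Qed.

Lemma lsum_swap {S T} (f : S -> T -> R) l l' :
  lsum (fun x => lsum (f x) l') l = lsum (fun y => lsum (fun x => f x y) l) l'.
Proof.
  induction l as [|x l IH]; simpl.
  - symmetry; apply lsum_zero; auto.
  - rewrite IH, <- lsum_plus. reflexivity.
Qed.

Lemma lsum_incl {T} (f : T -> R) l l' :
  (forall x, 0 <= f x) -> NoDup l -> incl l l' -> lsum f l <= lsum f l'.
Proof.
  intros H0; revert l'; induction l as [|x l IH]; intros l' Hnd Hi; simpl.
  - apply lsum_nonneg; auto.
  - inversion Hnd as [|? ? Hx Hl]; subst.
    destruct (in_split x l') as (l1 & l2 & ->); [apply Hi; simpl; auto|].
    assert (lsum f l <= lsum f (l1 ++ l2)).
    { apply IH; auto. intros y Hy.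
      assert (Hy' : In y (l1 ++ x :: l2)) by (apply Hi; simpl; auto).
      apply in_app_or in Hy'; apply in_or_app; simpl in Hy'.
      destruct Hy' as [|[->|]]; tauto. }
    rewrite lsum_app in *; simpl; lra.
Qed.

Lemma lsum_seq (f : nat -> R) n : sum_f_R0 f n = lsum f (seq 0 (S n)).
Proof.
  induction n as [|n IH]; [simpl; ring|].
  rewrite seq_S, lsum_app, <- IH. simpl. ring.
Qed.

Lemma lsum_seq_mono (f : nat -> R) n n' :
  (forall x, 0 <= f x) -> (n <= n')%nat -> lsum f (seq 0 n) <= lsum f (seq 0 n').
Proof.
  intros H Hn; apply lsum_incl; auto using seq_NoDup.
  intros k; rewrite !in_seq; lia.
Qed.

Lemma lsum_le_one {T} (f : T -> R) A l : 0 <= A -> (forall x, f x <= A) -> NoDup l ->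
  (forall x y, In x l -> In y l -> x <> y -> f x = 0 \/ f y = 0) -> lsum f l <= A.
Proof.
  intros HA Hf; induction l as [|x l IH]; simpl; intros Hnd H; [lra|].
  inversion Hnd as [|? ? Hx Hl]; subst.
  destruct (Req_dec (f x) 0) as [->|Hn].
  - assert (lsum f l <= A) by auto. lra.
  - rewrite (lsum_zero f l); [specialize (Hf x); lra|].
    intros y Hy. destruct (H x y) as [|]; auto; [congruence|tauto].
Qed.

(** At most two terms survive. This serves to count how often a short set meets disjoint longer
    intervals. *)
Lemma lsum_le_two {T} (f : T -> R) A l : 0 <= A -> (forall x, f x <= A) -> NoDup l ->
  (forall x y z, In x l -> In y l -> In z l -> x <> y -> x <> z -> y <> z ->
     f x = 0 \/ f y = 0 \/ f z = 0) -> lsum f l <= 2 * A.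
Proof.
  intros HA Hf; induction l as [|x l IH]; simpl; intros Hnd H; [lra|].
  inversion Hnd as [|? ? Hx Hl]; subst.
  destruct (Req_dec (f x) 0) as [->|Hn].
  - assert (lsum f l <= 2 * A) by (apply IH; auto). lra.
  - assert (lsum f l <= A).
    { apply lsum_le_one; auto. intros y z Hy Hz Hyz.
      destruct (H x y z) as [|]; auto; try (intros ->; auto); tauto. }
    specialize (Hf x); lra.
Qed.

(** Splits the cost of a cover that consists of two kinds of sets. *)
Lemma lsum_sum_type {S T} (f : S + T -> R) l : NoDup l -> exists l1 l2,
  NoDup l1 /\ NoDup l2 /\
  lsum f l = lsum (fun x => f (inl x)) l1 + lsum (fun y => f (inr y)) l2.
Proof.
  intros Hnd.
  enough (exists l1 l2, (NoDup l1 /\ NoDup l2 /\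
    lsum f l = lsum (fun x => f (inl x)) l1 + lsum (fun y => f (inr y)) l2) /\
    (forall x, In x l1 -> In (inl x) l) /\ (forall y, In y l2 -> In (inr y) l))
    by firstorder.
  induction l as [|z l IH].
  - exists nil, nil. simpl. repeat split; auto using NoDup_nil; try tauto; ring.
  - inversion Hnd as [|? ? Hz Hl]; subst.
    destruct (IH Hl) as (l1 & l2 & (N1 & N2 & E) & I1 & I2).
    destruct z as [x|y].
    + exists (x :: l1), l2. simpl. rewrite E.
      repeat split; auto; [constructor; auto|ring|].
      intros x' [->|]; auto.
    + exists l1, (y :: l2). simpl. rewrite E.
      repeat split; auto; [constructor; auto|ring|].
      intros x' [->|]; auto.
Qed.

(** * Powers and Hausdorff content *)

(** [pw r s] is [r^s] with [pw 0 s = 0], whereas [Rpower 0 s = 1]. *)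
Definition pw (r s : R) : R := if Rle_dec r 0 then 0 else Rpower r s.

Lemma Rpower_pos x y : 0 < Rpower x y.
Proof. apply exp_pos. Qed.

Lemma Rpower_1_l s : Rpower 1 s = 1.
Proof. unfold Rpower. now rewrite ln_1, Rmult_0_r, exp_0. Qed.

Lemma pw_pos r s : 0 < r -> pw r s = Rpower r s.
Proof. intros; unfold pw; destruct (Rle_dec r 0); lra. Qed.

Lemma pw_0 s : pw 0 s = 0.
Proof. unfold pw; destruct (Rle_dec 0 0); lra. Qed.

Lemma pw_nonneg r s : 0 <= pw r s.
Proof. unfold pw; destruct (Rle_dec r 0); [lra|apply Rlt_le, Rpower_pos]. Qed.

Lemma pw_scale a r s : 0 < a -> pw (a * r) s = Rpower a s * pw r s.
Proof.
  intros Ha; unfold pw; destruct (Rle_dec r 0), (Rle_dec (a * r) 0); try nra.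
  rewrite Rpower_mult_distr; lra.
Qed.

Lemma Rpower_le_compat a b s : 0 <= s -> 0 < a <= b -> Rpower a s <= Rpower b s.
Proof. intros; apply Rle_Rpower_l; lra. Qed.

Lemma Rpower_le_inv a b s : 0 < s -> 0 < b -> Rpower a s <= Rpower b s -> a <= b.
Proof.
  intros Hs Hb H; destruct (Rle_lt_dec a b) as [|Hlt]; auto.
  assert (Rpower b s < Rpower a s) by (apply Rlt_Rpower_l; lra). lra.
Qed.

Lemma Rpower_root x s : 0 < s -> 0 < x -> Rpower (Rpower x (/ s)) s = x.
Proof.
  intros; rewrite Rpower_mult, Rinv_l by lra. now apply Rpower_1.
Qed.

(** From [r^s = r^(s-t) * r^t]. Here a gap between [t] and [s] yields a factor that is small with
    [d]. *)
Lemma pw_interp r d s t : t <= s -> r <= d -> pw r s <= Rpower d (s - t) * pw r t.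
Proof.
  intros Hts Hr; unfold pw; destruct (Rle_dec r 0); [lra|].
  replace s with ((s - t) + t) at 1 by ring. rewrite Rpower_plus.
  apply Rmult_le_compat_r; [apply Rlt_le, Rpower_pos|].
  apply Rpower_le_compat; lra.
Qed.

Lemma sum_geom_le c n : 0 <= c -> sum_f_R0 (fun k => c * (/ 2) ^ S k) n <= c.
Proof.
  intros Hc.
  assert (sum_f_R0 (fun k => c * (/ 2) ^ S k) n = c - c * (/ 2) ^ S n) as ->.
  { induction n as [|n IH]; [simpl; lra|].
    change (sum_f_R0 (fun k => c * (/ 2) ^ S k) (S n)) with
      (sum_f_R0 (fun k => c * (/ 2) ^ S k) n + c * (/ 2) ^ S (S n)).
    rewrite IH. simpl. lra. }
  assert (0 <= (/ 2) ^ S n) by (apply pow_le; lra). nra.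
Qed.

(** Strict lower bound for the [s]-dimensional Hausdorff content, with covers
    indexed by any countable type and degenerate radii [0] allowed. *)
Definition content_gt (s : R) (E : R -> Prop) (c : R) : Prop :=
  forall (T : Type) (code : T -> nat), (forall i j, code i = code j -> i = j) ->
  forall (V : T -> R -> Prop) (rho : T -> R),
    (forall i, 0 <= rho i /\ diam_le (V i) (rho i)) ->
    (forall x, E x -> exists i, V i x) ->
    exists l, NoDup l /\ c < lsum (fun i => pw (rho i) s) l.

(** A cover that is cheap enough consists of short sets, and its radii can be made positive at
    little extra cost. It would thus be a cover of the kind excluded at some [eps] and [delta]. *)
Lemma not_null_content_gt s E : 0 < s -> ~ hausdorff_null s E ->
  exists c, 0 < c /\ content_gt s E c.
Proof.
  intros Hs Hn.
  assert (exists eps delta, 0 < eps /\ 0 < delta /\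
    forall U r, (forall k, 0 < r k <= delta /\ diam_le (U k) (r k)) ->
      (forall x, E x -> exists k, U k x) ->
      ~ forall n, sum_f_R0 (fun k => Rpower (r k) s) n <= eps)
    as (eps & delta & He & Hd & Hno).
  { apply NNPP; intros Hc. apply Hn. intros eps delta He Hd.
    apply NNPP; intros Hc'. apply Hc. exists eps, delta. repeat split; auto.
    intros U r H1 H2 H3. apply Hc'. exists U, r. auto. }
  (* Enlarging the radii will at most double the bound [c]. The total stays within [eps], and within
     [delta^s], so that every radius is at most [delta]. *)
  set (c := Rmin eps (Rpower delta s) / 2).
  assert (Hp := Rpower_pos delta s).
  assert (Hc : 0 < c /\ 2 * c <= eps /\ 2 * c <= Rpower delta s).
  { unfold c. assert (H := Rmin_l eps (Rpower delta s)).
    assert (H' := Rmin_r eps (Rpower delta s)).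
    assert (0 < Rmin eps (Rpower delta s)) by (apply Rmin_pos; auto). lra. }
  exists c. split; [lra|].
  intros T code Hinj V rho HV Hcov.
  apply NNPP; intros Hbad.
  assert (Hle : forall l, NoDup l -> lsum (fun i => pw (rho i) s) l <= c).
  { intros l Hl. apply Rnot_lt_le; intros H. apply Hbad. eauto. }
  (* Numbers that code no index receive radius [0] and, below, the empty set. *)
  assert (Hr : forall n, exists r, (r = 0 /\ forall i, code i <> n) \/
                                    (exists i, code i = n /\ r = rho i)).
  { intros n. destruct (classic (exists i, code i = n)) as [[i Hi]|Hno'].
    - exists (rho i). eauto.
    - exists 0. left. split; auto. intros i Hi; eauto. }
  apply functional_choice in Hr. destruct Hr as [rn Hrn].
  assert (Hrn0 : forall n, 0 <= rn n).
  { intros n. destruct (Hrn n) as [[-> _]|(i & _ & ->)]; [lra|apply HV]. }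
  (* [tiny n ^ s] is [c / 2^(n+1)], so all these radii together cost at most [c]. *)
  set (tiny := fun n => Rpower (c * (/ 2) ^ S n) (/ s)).
  set (r := fun n => Rmax (rn n) (tiny n)).
  assert (Ht : forall n, 0 < tiny n) by (intros; apply Rpower_pos).
  assert (Hr0 : forall n, 0 < r n).
  { intros n. unfold r. eapply Rlt_le_trans; [apply Ht|apply Rmax_r]. }
  assert (Hrs : forall n, Rpower (r n) s <= pw (rn n) s + c * (/ 2) ^ S n).
  { intros n. unfold r.
    assert (0 < c * (/ 2) ^ S n) by (apply Rmult_lt_0_compat; [lra|apply pow_lt; lra]).
    assert (H1 := pw_nonneg (rn n) s). specialize (Ht n).
    unfold Rmax; destruct (Rle_dec (rn n) (tiny n)) as [|Hgt].
    - unfold tiny. rewrite Rpower_root; lra.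
    - rewrite pw_pos; lra. }
  assert (Hsum1 : forall n, sum_f_R0 (fun k => pw (rn k) s) n <= c).
  { intros n. rewrite lsum_seq.
    (* The terms with codes below [N] form a sum over a duplicate-free list of indices, to which
       [Hle] applies. *)
    enough (forall N, exists l, NoDup l /\ (forall i, In i l -> (code i < N)%nat) /\
      lsum (fun k => pw (rn k) s) (seq 0 N) = lsum (fun i => pw (rho i) s) l) as Hl.
    { destruct (Hl (S n)) as (l & H1 & _ & ->). auto. }
    intros N; induction N as [|N (l & H1 & H2 & H3)].
    - exists nil. simpl. repeat split; auto using NoDup_nil; tauto.
    - rewrite seq_S, lsum_app, H3.
      simpl. destruct (Hrn N) as [[-> _]|(i & Hi & ->)].
      + exists l. rewrite pw_0. repeat split; auto; [|ring].
        intros j Hj; specialize (H2 j Hj); lia.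
      + exists (i :: l). repeat split; simpl; [|intros j [<-|Hj]|ring].
        * constructor; auto. intros Hin. specialize (H2 _ Hin); lia.
        * lia.
        * specialize (H2 j Hj); lia. }
  assert (Hsum : forall n, sum_f_R0 (fun k => Rpower (r k) s) n <= 2 * c).
  { intros n.
    apply Rle_trans with
      (sum_f_R0 (fun k => pw (rn k) s + c * (/ 2) ^ S k) n).
    - apply sum_Rle; auto.
    - rewrite sum_plus. specialize (Hsum1 n).
      assert (H := sum_geom_le c n). lra. }
  apply (Hno (fun n x => exists i, code i = n /\ V i x) r).
  - intros k. split; [split; auto|].
    + apply Rpower_le_inv with s; auto.
      apply Rle_trans with (2 * c); [|lra].
      eapply Rle_trans; [|apply (Hsum k)]. rewrite lsum_seq.
      assert (H := lsum_incl (fun k => Rpower (r k) s) [k] (seq 0 (S k))).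
      simpl lsum at 1 in H. rewrite Rplus_0_r in H. apply H.
      * intros; apply Rlt_le, Rpower_pos.
      * constructor; [simpl; tauto|constructor].
      * intros y [<-|[]]. rewrite in_seq; lia.
    + intros x y (i & Hi & Hx) (j & Hj & Hy).
      assert (i = j) by (apply Hinj; congruence). subst j.
      apply Rle_trans with (rho i); [apply HV; auto|].
      destruct (Hrn k) as [[_ H]|(j & Hj' & E')]; [exfalso; eapply H; eauto|].
      assert (i = j) by (apply Hinj; congruence). subst j.
      rewrite <- E'. apply Rmax_l.
  - intros x Hx. destruct (Hcov x Hx) as [i Hi]. eauto.
  - intros n. specialize (Hsum n). lra.
Qed.

(** * Covers and light intervals *)

Definition hits (A : R -> Prop) (a b : R) : Prop := exists u, A u /\ a <= u < b.

Definition hit_mass (U : nat -> R -> Prop) (r : nat -> R) (t a b : R) (k : nat) : R :=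
  if excluded_middle_informative (hits (U k) a b) then Rpower (r k) t else 0.

(** Bounding all partial sums replaces the infinite sum of the masses. *)
Definition weight_le U r t a b (W : R) : Prop :=
  forall N, lsum (hit_mass U r t a b) (seq 0 N) <= W.

Lemma hit_mass_nonneg U r t a b k : 0 <= hit_mass U r t a b k.
Proof.
  unfold hit_mass; destruct excluded_middle_informative; [|lra].
  apply Rlt_le, Rpower_pos.
Qed.

Lemma hit_mass_mono U r t a b a' b' k :
  a <= a' -> b' <= b -> hit_mass U r t a' b' k <= hit_mass U r t a b k.
Proof.
  intros Ha Hb. unfold hit_mass.
  destruct (excluded_middle_informative (hits (U k) a' b')) as [(u & Hu & Hab)|],
    (excluded_middle_informative (hits (U k) a b)) as [|Hn];
    try lra; try (apply Rlt_le, Rpower_pos).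
  exfalso; apply Hn. exists u. split; auto; lra.
Qed.

Lemma weight_le_mono U r t a b a' b' W W' :
  a <= a' -> b' <= b -> W <= W' -> weight_le U r t a b W -> weight_le U r t a' b' W'.
Proof.
  intros Ha Hb HW H N. eapply Rle_trans; [|apply (Rle_trans _ _ _ (H N) HW)].
  apply lsum_le; intros; apply hit_mass_mono; auto.
Qed.

(** A single mass is at most the whole weight. Hence an interval of small weight meets no large set
    of the cover. *)
Lemma weight_radius U r t a b W k : 0 < t -> 0 < W ->
  weight_le U r t a b (Rpower W t) -> hits (U k) a b -> r k <= W.
Proof.
  intros Ht HW0 HW Hh. apply Rpower_le_inv with t; auto.
  eapply Rle_trans; [|apply (HW (S k))].
  assert (H := lsum_incl (hit_mass U r t a b) [k] (seq 0 (S k))).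
  simpl lsum at 1 in H. rewrite Rplus_0_r in H.
  unfold hit_mass at 2 in H. destruct excluded_middle_informative; [|tauto].
  apply H.
  - apply hit_mass_nonneg.
  - constructor; [simpl; tauto|constructor].
  - intros y [<-|[]]. rewrite in_seq; lia.
Qed.

Lemma Rabs_le_inv x d : Rabs x <= d -> - d <= x <= d.
Proof. unfold Rabs; destruct (Rcase_abs x); lra. Qed.

(* Of three disjoint intervals the middle one lies between any points of the
   outer two. *)
Lemma three_hits (A : R -> Prop) d a1 b1 a2 b2 a3 b3 :
  diam_le A d -> hits A a1 b1 -> hits A a2 b2 -> hits A a3 b3 ->
  d < b1 - a1 -> d < b2 - a2 -> d < b3 - a3 ->
  b1 <= a2 \/ b2 <= a1 -> b1 <= a3 \/ b3 <= a1 -> b2 <= a3 \/ b3 <= a2 -> False.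
Proof.
  intros HA (u1 & A1 & I1) (u2 & A2 & I2) (u3 & A3 & I3) L1 L2 L3 D12 D13 D23.
  assert (H12 := HA _ _ A1 A2). assert (H13 := HA _ _ A1 A3).
  assert (H23 := HA _ _ A2 A3).
  apply Rabs_le_inv in H12, H13, H23.
  destruct D12, D13, D23; lra.
Qed.

(* If all the intervals were heavy, [X] would be covered too cheaply by the
   threefold enlargements of those [U k] that hit an interval no longer than
   [r k], together with the intervals hit only by shorter [U k].  Each [U k]
   counts for at most two of the latter. *)
Lemma light_interval (U : nat -> R -> Prop) (r : nat -> R) (t s a b W c2 delta c : R)
  (X : R -> Prop) (al be : R -> R) (idx : R -> nat) :
  0 < t < s -> 0 < W -> 0 < c2 -> 0 < delta ->
  (forall k, 0 < r k /\ diam_le (U k) (r k)) ->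
  weight_le U r t a b (Rpower W t) ->
  content_gt s X c ->
  (forall x, X x -> a <= al x <= x /\ x < be x <= b /\ be x - al x <= delta) ->
  (forall x y, X x -> X y -> idx x = idx y -> al x = al y /\ be x = be y) ->
  (forall x y, X x -> X y -> idx x <> idx y -> be x <= al y \/ be y <= al x) ->
  Rpower (3 * W) s + Rpower delta (s - t) * (2 / c2 * Rpower W t) <= c ->
  exists x, X x /\ weight_le U r t (al x) (be x) (c2 * Rpower (be x - al x) t).
Proof.
  intros Hts HW Hc2 Hdelta HU Hw Hcont Hint Hsame Hdisj Hc.
  apply NNPP; intros Hno.
  assert (Hheavy : forall x, X x -> exists N, forall N', (N <= N')%nat ->
    c2 * Rpower (be x - al x) t < lsum (hit_mass U r t (al x) (be x)) (seq 0 N')).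
  { intros x Hx. apply NNPP; intros H. apply Hno. exists x. split; auto.
    intros N. apply Rnot_lt_le. intros HN. apply H. exists N. intros N' HN'.
    eapply Rlt_le_trans; [apply HN|]. apply lsum_seq_mono; auto.
    apply hit_mass_nonneg. }
  (* An interval is small if every [U k] that meets it has radius below its length. [S] holds the
     indices of such intervals. *)
  set (small := fun x => forall k, hits (U k) (al x) (be x) -> r k < be x - al x).
  set (S := fun i => exists x, X x /\ small x /\ idx x = i).
  assert (Hrep : forall i, exists x, S i -> X x /\ small x /\ idx x = i).
  { intros i. destruct (classic (S i)) as [[x Hx]|H]; [exists x; auto|].
    exists 0. tauto. }
  apply functional_choice in Hrep. destruct Hrep as [rep Hrep].
  set (len := fun i => if excluded_middle_informative (S i)
                       then be (rep i) - al (rep i) else 0).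
  (* The [r k]-neighbourhood of the part of [U k] in [[a,b)] has diameter at most [3 * r k]. *)
  set (hitA := fun k => if excluded_middle_informative (hits (U k) a b)
                        then 3 * r k else 0).
  set (VA := fun k y => exists u, U k u /\ a <= u < b /\ Rabs (y - u) <= r k).
  set (VB := fun i y => S i /\ al (rep i) <= y < be (rep i)).
  set (V := fun z : nat + nat => match z with inl k => VA k | inr i => VB i end).
  set (rho := fun z : nat + nat => match z with inl k => hitA k | inr i => len i end).
  set (code := fun z : nat + nat => match z with inl k => (2 * k)%nat
                                            | inr i => (2 * i + 1)%nat end).
  destruct (Hcont (nat + nat)%type code) with (V := V) (rho := rho) as (l & Hl & Hsum).
  - intros [k|i] [k'|i']; unfold code; intros E; try f_equal; lia.
  - intros [k|i]; simpl.
    + destruct (HU k) as [Hrk Hd]. unfold hitA.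
      destruct excluded_middle_informative as [|Hn]; split; try lra.
      * intros x y (u & Hu & _ & Hxu) (v & Hv & _ & Hyv).
        assert (H := Hd u v Hu Hv). apply Rabs_le_inv in H, Hxu, Hyv.
        apply Rabs_le. lra.
      * intros x y (u & Hu & Hab & _). exfalso; apply Hn. exists u; auto.
    + unfold len. destruct excluded_middle_informative as [HS|HS].
      * destruct (Hrep i HS) as (Hx & _ & _). destruct (Hint _ Hx) as (? & ? & ?).
        split; [lra|]. intros x y [_ Hx'] [_ Hy']. apply Rabs_le. lra.
      * split; [lra|]. intros x y [Hx' _]; tauto.
  - intros x Hx. destruct (classic (small x)) as [Hs|Hs].
    + exists (inr (idx x)). unfold V, VB. assert (HS : S (idx x)) by (exists x; auto).
      destruct (Hrep _ HS) as (Hy & _ & E). destruct (Hsame _ _ Hy Hx E) as [-> ->].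
      destruct (Hint x Hx). split; auto; lra.
    (* Some [U k] meets the interval of [x] and has [r k] at least its length, so [x] is within
       [r k] of a point of [U k]. *)
    + apply not_all_ex_not in Hs. destruct Hs as [k Hk].
      apply imply_to_and in Hk. destruct Hk as [(u & Hu & Hab) Hrk].
      exists (inl k). unfold V, VA. destruct (Hint x Hx) as (? & ? & ?).
      exists u. split; auto. split; [lra|]. apply Rabs_le. lra.
  - destruct (lsum_sum_type (fun z => pw (rho z) s) l Hl) as (lA & lB & NA & NB & E). rewrite E in Hsum.
    clear E Hl l. simpl in Hsum.
    assert (HA : lsum (fun k => pw (hitA k) s) lA <= Rpower (3 * W) s).
    (* By [weight_radius] each hitting [r k] is at most [W], so
       [(3 * r k)^s <= 3^s * W^(s-t) * (r k)^t]. *)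
    { set (C := Rpower 3 s * Rpower W (s - t)).
      assert (0 < C) by (apply Rmult_lt_0_compat; apply Rpower_pos).
      apply Rle_trans with (C * Rpower W t).
      - apply Rle_trans with (lsum (fun k => C * hit_mass U r t a b k) lA).
        + apply lsum_le. intros k _. unfold hitA, hit_mass.
          destruct excluded_middle_informative as [Hh|]; [|rewrite pw_0; lra].
          destruct (HU k) as [Hrk _].
          rewrite pw_scale by lra. unfold C. rewrite Rmult_assoc.
          apply Rmult_le_compat_l; [apply Rlt_le, Rpower_pos|].
          rewrite <- (pw_pos (r k) t) by auto. apply pw_interp; [lra|].
          apply (weight_radius U r t a b); auto; lra.
        + rewrite lsum_scal. apply Rmult_le_compat_l; [lra|].
          eapply Rle_trans; [|apply (Hw (Datatypes.S (list_max lA)))].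
          apply lsum_incl; auto using hit_mass_nonneg.
          intros k Hk. rewrite in_seq. split; [lia|].
          assert (H' := proj1 (list_max_le lA (list_max lA)) (Nat.le_refl _)).
          rewrite Forall_forall in H'. specialize (H' k Hk). lia.
      - unfold C. rewrite Rmult_assoc, <- Rpower_plus.
        replace (s - t + t) with s by ring. rewrite Rpower_mult_distr by lra. lra. }
    (* Heaviness bounds [c2 * len^t] by the mass in the interval. Exchanging the sums counts each
       [U k] at most twice, and [len <= delta] gives the other factor. *)
    assert (HB : lsum (fun i => pw (len i) s) lB <=
                 Rpower delta (s - t) * (2 / c2 * Rpower W t)).
    { apply Rle_trans with (lsum (fun i => Rpower delta (s - t) * pw (len i) t) lB).
      { apply lsum_le. intros i _. apply pw_interp; [lra|]. unfold len.
        destruct excluded_middle_informative as [HS|]; [|lra].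
        destruct (Hrep i HS) as (Hx & _). apply Hint in Hx. lra. }
      rewrite lsum_scal. apply Rmult_le_compat_l; [apply Rlt_le, Rpower_pos|].
      set (h := fun i k => if excluded_middle_informative (S i)
                 then hit_mass U r t (al (rep i)) (be (rep i)) k else 0).
      assert (Hh0 : forall i k, 0 <= h i k).
      { intros i k; unfold h; destruct excluded_middle_informative;
          [apply hit_mass_nonneg|lra]. }
      assert (HN : exists N, forall i, In i lB -> forall N', (N <= N')%nat ->
                c2 * pw (len i) t <= lsum (h i) (seq 0 N')).
      { clear NB Hsum. induction lB as [|i lB [N IH]].
        - exists 0%nat. simpl; tauto.
        - assert (exists M, forall N', (M <= N')%nat ->
                    c2 * pw (len i) t <= lsum (h i) (seq 0 N')) as [M HM].
          { unfold len, h. destruct excluded_middle_informative as [HS|HS].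
            - destruct (Hrep i HS) as (Hx & _). destruct (Hheavy _ Hx) as [M HM].
              exists M. intros N' HN'. destruct (Hint _ Hx) as (? & ? & ?).
              rewrite pw_pos by lra. apply Rlt_le. auto.
            - exists 0%nat. intros. rewrite pw_0, lsum_zero; auto; lra. }
          exists (max M N). intros j [<-|Hj] N' HN'; [apply HM|apply IH; auto]; lia. }
      destruct HN as [N HN].
      assert (Hfin : c2 * lsum (fun i => pw (len i) t) lB <= 2 * Rpower W t).
      { rewrite <- lsum_scal.
        apply Rle_trans with (lsum (fun i => lsum (h i) (seq 0 N)) lB).
        { apply lsum_le. intros i Hi; apply HN; auto. }
        rewrite lsum_swap.
        apply Rle_trans with (lsum (fun k => 2 * hit_mass U r t a b k) (seq 0 N)).
        2: { rewrite lsum_scal. specialize (Hw N). lra. }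
        apply lsum_le. intros k _. apply lsum_le_two; auto.
        - apply hit_mass_nonneg.
        - intros i. unfold h. destruct excluded_middle_informative as [HS|];
            [|apply hit_mass_nonneg].
          destruct (Hrep i HS) as (Hx & _). apply Hint in Hx.
          apply hit_mass_mono; lra.
        - intros i1 i2 i3 _ _ _ D12 D13 D23.
          assert (Hz : forall i, h i k <> 0 -> S i /\ hits (U k) (al (rep i)) (be (rep i))).
          { intros i. unfold h, hit_mass.
            destruct excluded_middle_informative; [|lra].
            destruct excluded_middle_informative; [tauto|lra]. }
          destruct (Req_dec (h i1 k) 0) as [|Z1]; auto.
          destruct (Req_dec (h i2 k) 0) as [|Z2]; auto.
          destruct (Req_dec (h i3 k) 0) as [|Z3]; auto.
          exfalso.
          destruct (Hz _ Z1) as [S1 H1], (Hz _ Z2) as [S2 H2], (Hz _ Z3) as [S3 H3].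
          destruct (Hrep _ S1) as (X1 & M1 & E1), (Hrep _ S2) as (X2 & M2 & E2),
            (Hrep _ S3) as (X3 & M3 & E3).
          apply (three_hits (U k) (r k) _ _ _ _ _ _ (proj2 (HU k)) H1 H2 H3);
            try (apply M1 || apply M2 || apply M3; auto);
            apply Hdisj; congruence. }
      apply Rmult_le_reg_l with c2; auto.
      replace (c2 * (2 / c2 * Rpower W t)) with (2 * Rpower W t) by (field; lra). auto. }
    lra.
Qed.

(** * Cylinders and bounded distortion *)

(** Strictness comes from the expansion inequality. As no branch decreases, preimages of half-open
    intervals are again closed on the left. *)
Lemma branch_increasing M j : is_expanding_map M -> (j < eg M)%nat ->
  forall x y, in_piece M j x -> in_piece M j y -> x < y -> ef M x < ef M y.
Proof.
  intros (Hg & Hu & Hp & Hd & Hmon & Honto & Hexp & Hsh) Hj x y Hx Hy Hxy.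
  assert (Hne := Hexp j Hj x y Hx Hy). destruct (Hp j Hj) as [[H0 H1] H2].
  assert (Hlo : in_piece M j (elo M j)) by (unfold in_piece; lra).
  (* A decreasing branch would attain its supremum at [elo M j], but the
     supremum 1 of [[0,1)] is not attained. *)
  destruct (Hmon j Hj) as [Hi|Hdec].
  - assert (H := Hi x y Hx Hy (Rlt_le _ _ Hxy)).
    destruct (Req_dec (ef M x) (ef M y)) as [E|]; [|lra].
    rewrite E, Rminus_diag, Rabs_R0 in Hne.
    apply Rabs_le_inv in Hne. lra.
  - exfalso.
    assert (Hl : unit_int (ef M (elo M j))) by (apply Hu; unfold unit_int; lra).
    unfold unit_int in Hl.
    destruct (Honto j Hj ((ef M (elo M j) + 1) / 2)) as (z & Hz & E);
      [unfold unit_int; lra|].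
    assert (H := Hdec _ _ Hlo Hz (proj1 Hz)). lra.
Qed.

Lemma iter_unit M n x : is_expanding_map M -> unit_int x ->
  unit_int (Nat.iter n (ef M) x).
Proof.
  intros (_ & Hu & _) Hx. induction n as [|n IH]; simpl; auto.
Qed.

(** Induction on [n]: the iterate [f^n] is an increasing bijection from the old cylinder onto
    [[0,1)], and the new cylinder is the preimage of one piece. *)
Lemma cyl_interval M w n : is_expanding_map M -> (forall k, (k < n)%nat -> (w k < eg M)%nat) ->
  exists a b, (0 <= a < b /\ b <= 1) /\
    (forall x, cyl M w n x <-> a <= x < b) /\
    (forall x y, a <= x < b -> a <= y < b -> x < y ->
       Nat.iter n (ef M) x < Nat.iter n (ef M) y) /\
    (forall y, unit_int y -> exists x, a <= x < b /\ Nat.iter n (ef M) x = y).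
Proof.
  intros HM. induction n as [|n IH]; intros Hw.
  - exists 0, 1. split; [lra|]. split; [|split; [auto|]].
    + intros x. split; [intros [Hx _]; exact Hx|]. intros Hx. split; [exact Hx|lia].
    + intros y Hy. exists y. split; auto.
  - destruct IH as (a & b & Hab & Hcyl & Hinc & Honto); [auto|].
    assert (Hj : (w n < eg M)%nat) by auto.
    assert (Hbr := branch_increasing M (w n) HM Hj).
    assert (Hit := fun x => iter_unit M n x HM).
    destruct HM as (_ & Hu & Hp & Hd & _ & Ho & _).
    destruct (Hp _ Hj) as [H01 H2].
    set (phi := Nat.iter n (ef M)) in *.
    destruct (Honto (elo M (w n))) as (a' & Ha' & Ea'); [unfold unit_int; lra|].
    (* The right end is the preimage of [ehi], unless [ehi] is [1], which is not a value of [phi];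
       then [b] stays. *)
    assert (exists b', a' < b' <= b /\
      forall x, a' <= x < b -> (phi x < ehi M (w n) <-> x < b')) as (b' & Hb' & Eb').
    { destruct (Rlt_le_dec (ehi M (w n)) 1) as [Hlt|Hge].
      - destruct (Honto (ehi M (w n))) as (b' & Hb' & Eb'); [unfold unit_int; lra|].
        exists b'. rewrite <- Eb'. split.
        + split; [|lra]. destruct (Rtotal_order a' b') as [|[E|Hlt']]; auto.
          * rewrite E in Ea'. lra.
          * specialize (Hinc b' a' Hb' Ha' Hlt'). lra.
        + intros x Hx. split; intros Hlt'; [|apply Hinc; lra].
          destruct (Rtotal_order x b') as [|[->|Hgt]]; auto; [lra|].
          assert (phi b' < phi x) by (apply Hinc; lra). lra.
      - exists b. split; [lra|]. intros x Hx.
        assert (H : unit_int (phi x)) by (apply Hit; unfold unit_int; lra).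
        unfold unit_int in H. lra. }
    assert (Hpc : forall x, a <= x < b -> (in_piece M (w n) (phi x) <-> a' <= x < b')).
    { intros x Hx. unfold in_piece. split.
      - intros [H1 H3].
        assert (a' <= x).
        { apply Rnot_lt_le; intros Hlt. assert (phi x < phi a') by (apply Hinc; auto). lra. }
        split; auto. apply Eb'; lra.
      - intros [H1 H3]. split; [|apply Eb'; lra].
        rewrite <- Ea'. destruct (Req_dec a' x) as [->|]; [lra|].
        apply Rlt_le, Hinc; auto; lra. }
    exists a', b'. split; [lra|]. split; [|split].
    + intros x. split.
      * intros [Hx Hk].
        assert (Hab' : a <= x < b) by (apply Hcyl; split; auto).
        apply Hpc; auto. apply (Hd (phi x)); auto. apply Hk; auto.
      * intros Hx. assert (Hab' : a <= x < b) by lra.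
        destruct (proj2 (Hcyl x) Hab') as [Hx1 Hk]. split; auto.
        intros k Hkn. destruct (Nat.eq_dec k n) as [->|]; [|apply Hk; lia].
        apply (Hd (phi x)); auto. apply Hpc; auto.
    + intros x y Hx Hy Hxy. simpl. apply Hbr; try (apply Hpc; lra).
      apply Hinc; lra.
    + intros y Hy. destruct (Ho _ Hj y Hy) as (z & Hz & Ez).
      destruct (Honto z) as (x & Hx & Ex); [unfold unit_int, in_piece in *; lra|].
      exists x. split; [|simpl; fold phi; rewrite Ex; auto].
      apply Hpc; auto. fold phi. rewrite Ex. auto.
Qed.

(** [MVT_cor2] expects a derivative function, which choice assembles from the pointwise
    derivatives. *)
Lemma mean_value_lim (phi : R -> R) x y : x < y ->
  (forall z, x <= z <= y -> exists d, derivable_pt_lim phi z d) ->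
  exists z d, x < z < y /\ derivable_pt_lim phi z d /\ phi y - phi x = d * (y - x).
Proof.
  intros Hxy Hd.
  assert (Hd' : forall z, exists d, x <= z <= y -> derivable_pt_lim phi z d).
  { intros z. destruct (classic (x <= z <= y)) as [H|]; [|exists 0; tauto].
    destruct (Hd z H) as [d Hd']. eauto. }
  apply functional_choice in Hd'. destruct Hd' as [phi' Hphi'].
  destruct (MVT_cor2 phi phi' x y Hxy Hphi') as (z & E & Hz).
  exists z, (phi' z). repeat split; try apply Hz; auto. apply Hphi'; lra.
Qed.

(* Somewhere in the cylinder the derivative of [f^n] is at most [2 / (b - a)],
   since the middle half is mapped into the unit interval. *)
Lemma iter_lipschitz M : is_expanding_map M -> bounded_distortion M ->
  exists K, 0 < K /\ forall w n a b,
    (forall k, (k < n)%nat -> (w k < eg M)%nat) ->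
    a < b -> (forall x, cyl M w n x <-> a <= x < b) ->
    forall x y, a <= x < b -> a <= y < b ->
      Rabs (Nat.iter n (ef M) x - Nat.iter n (ef M) y) <= K / (b - a) * Rabs (x - y).
Proof.
  intros HM (K & HK & HD). exists (2 * K). split; [lra|].
  intros w n a b Hw Hab Hcyl. destruct (HD n w) as [Hdiff Hdist].
  destruct (cyl_interval M w n HM Hw) as (a1 & b1 & Hab1 & Hcyl1 & Hinc & Honto).
  assert (Hiff : forall x, a1 <= x < b1 <-> a <= x < b)
    by (intros x; rewrite <- Hcyl1; apply Hcyl).
  assert (Hu := fun x (Hx : a <= x < b) =>
    iter_unit M n x HM (proj1 (proj2 (Hcyl x) Hx))).
  set (phi := Nat.iter n (ef M)) in *.
  assert (Hin : forall z, a < z < b -> Defs.interior (cyl M w n) z).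
  { intros z Hz. exists (Rmin (z - a) (b - z)).
    split; [apply Rmin_pos; lra|]. intros v Hv. apply Hcyl.
    assert (H1 := Rmin_l (z - a) (b - z)). assert (H2 := Rmin_r (z - a) (b - z)).
    apply Rabs_def2 in Hv. lra. }
  destruct (mean_value_lim phi (a + (b - a) / 4) (b - (b - a) / 4))
    as (z0 & d0 & Hz0 & Hd0 & E0).
  { lra. }
  { intros z Hz. apply Hdiff, Hin. lra. }
  assert (Hd0' : Rabs d0 <= 2 / (b - a)).
  { assert (H1 := Hu (a + (b - a) / 4)). assert (H2 := Hu (b - (b - a) / 4)).
    unfold unit_int in *.
    assert (-1 <= d0 * ((b - a) / 2) <= 1).
    { replace (d0 * ((b - a) / 2)) with (phi (b - (b - a) / 4) - phi (a + (b - a) / 4))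
        by (rewrite E0; field). lra. }
    apply Rabs_le.
    replace d0 with (d0 * ((b - a) / 2) * (2 / (b - a))) by (field; lra).
    assert (0 < 2 / (b - a)) by (apply Rdiv_lt_0_compat; lra). nra. }
  set (L := 2 * K / (b - a)).
  assert (HL0 : 0 < L) by (apply Rdiv_lt_0_compat; lra).
  (* Bounded distortion carries the bound at [z0] to every interior point. *)
  assert (HL : forall z d, a < z < b -> derivable_pt_lim phi z d -> d <= L).
  { intros z d Hz Hd.
    assert (H := Hdist z z0 d d0 (Hin z Hz) (Hin z0 ltac:(lra)) Hd Hd0).
    assert (K * Rabs d0 <= K * (2 / (b - a))) by (apply Rmult_le_compat_l; lra).
    replace (K * (2 / (b - a))) with L in * by (unfold L; field; lra).
    assert (H' := Rle_abs d). lra. }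
  assert (Hopen : forall x y, a < x -> x < y -> y < b -> phi y - phi x <= L * (y - x)).
  { intros x y Hx Hxy Hy.
    destruct (mean_value_lim phi x y Hxy) as (z & d & Hz & Hd & E).
    { intros z Hz. apply Hdiff, Hin. lra. }
    rewrite E. apply Rmult_le_compat_r; [lra|]. apply (HL z); auto; lra. }
  (* The end [a] is not an interior point, and continuity there is not given. Since [f^n] is onto,
     it takes values just above [phi x] at points [z] between [x] and [y], and [Hopen] applies from
     [z] on. *)
  assert (Hclosed : forall x y, a <= x -> x < y -> y < b -> phi y - phi x <= L * (y - x)).
  { intros x y Hx Hxy Hy.
    assert (Hinc' : phi x < phi y) by (apply Hinc; auto; apply Hiff; lra).
    apply Rle_plus_epsilon. intros e He.
    assert (Hux := Hu x ltac:(lra)). assert (Huy := Hu y ltac:(lra)).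
    unfold unit_int in *.
    set (v := Rmin (phi x + e) ((phi x + phi y) / 2)).
    assert (H1 : v <= phi x + e) by apply Rmin_l.
    assert (H2 : v <= (phi x + phi y) / 2) by apply Rmin_r.
    assert (H3 : phi x < v) by (apply Rmin_glb_lt; lra).
    destruct (Honto v) as (z & Hz & Ez); [unfold unit_int; lra|]. apply Hiff in Hz.
    assert (x < z).
    { apply Rnot_le_lt; intros [H|H].
      - assert (phi z < phi x) by (apply Hinc; auto; apply Hiff; lra). lra.
      - subst z. lra. }
    assert (z < y).
    { apply Rnot_le_lt; intros [H'|H'].
      - assert (phi y < phi z) by (apply Hinc; auto; apply Hiff; lra). lra.
      - subst z. lra. }
    assert (H' := Hopen z y ltac:(lra) ltac:(lra) ltac:(lra)).
    assert (L * (y - z) <= L * (y - x)) by (apply Rmult_le_compat_l; lra). lra. }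
  assert (Hpos : forall x y, a <= x < b -> a <= y < b -> x < y ->
            Rabs (phi y - phi x) <= L * Rabs (y - x)).
  { intros x y Hx Hy Hxy.
    assert (phi x < phi y) by (apply Hinc; auto; apply Hiff; lra).
    rewrite !Rabs_right by lra. apply Hclosed; lra. }
  intros x y Hx Hy. fold L.
  destruct (Rtotal_order x y) as [H|[->|H]].
  - rewrite (Rabs_minus_sym (phi x)), (Rabs_minus_sym x). auto.
  - rewrite !Rminus_diag, Rabs_R0. lra.
  - auto.
Qed.

(** Naming a cylinder by one of its points in [[0,1)] makes it nonempty and its word valid. *)
Definition dcyl (M : emap) (x : R) (n : nat) : R -> Prop := cyl M (fun k => digit M k x) n.

Lemma digit_lt M k x : is_expanding_map M -> unit_int x -> (digit M k x < eg M)%nat.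
Proof.
  intros HM Hx. apply (iter_unit M k x HM) in Hx.
  destruct HM as (_ & _ & _ & Hd & _). apply (Hd _ Hx).
Qed.

Lemma dcyl_refl M x n : unit_int x -> dcyl M x n x.
Proof. intros Hx; split; auto. Qed.

Lemma dcyl_eq M x y n : dcyl M x n y -> forall z, dcyl M y n z <-> dcyl M x n z.
Proof.
  intros [_ H] z. unfold dcyl, cyl.
  split; intros [Hz H']; split; auto; intros k Hk; rewrite (H' k Hk);
    [|symmetry]; apply H; auto.
Qed.

Lemma dcyl_mono M x n n' y : (n <= n')%nat -> dcyl M x n' y -> dcyl M x n y.
Proof. intros Hn [Hy H]. split; auto. intros; apply H; lia. Qed.

Lemma dcyl_interval M x n : is_expanding_map M -> unit_int x ->
  exists a b, (0 <= a < b /\ b <= 1) /\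
    (forall z, dcyl M x n z <-> a <= z < b) /\
    (forall y, unit_int y -> exists z, a <= z < b /\ Nat.iter n (ef M) z = y).
Proof.
  intros HM Hx.
  destruct (cyl_interval M (fun k => digit M k x) n HM) as (a & b & H1 & H2 & _ & H3).
  - intros; apply digit_lt; auto.
  - exists a, b. auto.
Qed.

Lemma dcyl_shrink M x eps : is_expanding_map M -> unit_int x -> 0 < eps ->
  exists N, forall n, (N <= n)%nat -> diam_le (dcyl M x n) eps.
Proof.
  intros HM Hx He. assert (H := fun k => digit_lt M k x HM Hx).
  destruct HM as (_ & _ & _ & _ & _ & _ & _ & Hs).
  apply (Hs (fun k => digit M k x)); auto.
Qed.

Lemma piece_length_lower M : is_expanding_map M ->
  exists l, 0 < l /\ forall j, (j < eg M)%nat -> l <= ehi M j - elo M j.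
Proof.
  intros (_ & _ & Hp & _).
  enough (forall g, (g <= eg M)%nat -> exists l, 0 < l /\
            forall j, (j < g)%nat -> l <= ehi M j - elo M j) by eauto.
  intros g; induction g as [|g IH]; intros Hg.
  - exists 1. split; [lra|lia].
  - destruct IH as (l & Hl & H); [lia|].
    destruct (Hp g) as [Hg' _]; [lia|].
    exists (Rmin l (ehi M g - elo M g)). split; [apply Rmin_pos; lra|].
    intros j Hj. destruct (Nat.eq_dec j g) as [->|]; [apply Rmin_r|].
    eapply Rle_trans; [apply Rmin_l|apply H; lia].
Qed.

(** The smaller cylinder is mapped by [f^n] onto a whole piece, of length at least [l], while [f^n]
    stretches by at most [K / (b - a)]. *)
Lemma dcyl_ratio M : is_expanding_map M -> bounded_distortion M ->
  exists c, 0 < c /\ forall x n a b a' b', unit_int x ->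
    (forall z, dcyl M x n z <-> a <= z < b) ->
    (forall z, dcyl M x (S n) z <-> a' <= z < b') ->
    c * (b - a) <= b' - a'.
Proof.
  intros HM HB. destruct (iter_lipschitz M HM HB) as (K & HK & HL).
  destruct (piece_length_lower M HM) as (l & Hl & Hlen).
  exists (l / (2 * K)). split; [apply Rdiv_lt_0_compat; lra|].
  intros x n a b a' b' Hx Hab Hab'.
  assert (Hdig := fun k => digit_lt M k x HM Hx).
  assert (Ha : a < b) by (assert (H := proj1 (Hab x) (dcyl_refl M x n Hx)); lra).
  destruct (dcyl_interval M x n HM Hx) as (a1 & b1 & _ & H1 & Honto).
  specialize (HL (fun k => digit M k x) n a b (fun k _ => Hdig k) Ha Hab).
  set (j := digit M n x) in *. assert (Hj := Hdig n). fold j in Hj.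
  specialize (Hlen j Hj).
  assert (Hp := HM). destruct Hp as (_ & _ & Hp & Hd & _).
  destruct (Hp j Hj) as [Hp1 Hp2].
  assert (Hpt : forall y, in_piece M j y ->
            exists z, a <= z < b /\ a' <= z < b' /\ Nat.iter n (ef M) z = y).
  { intros y Hy.
    assert (Huy : unit_int y) by (unfold unit_int, in_piece in *; lra).
    destruct (Honto y Huy) as (z & Hz & E).
    apply H1 in Hz. exists z. split; [apply Hab; auto|]. split; auto.
    apply Hab'. destruct Hz as [Hz Hk]. split; auto. intros k Hkn.
    destruct (Nat.eq_dec k n) as [->|]; [|apply Hk; lia].
    rewrite E. apply (Hd y Huy); auto. }
  (* The right end of the piece is excluded, so the image is measured from [elo] to [elo + l / 2].
     This accounts for the [2] in the constant. *)
  destruct (Hpt (elo M j)) as (z1 & Hz1 & Hz1' & E1); [unfold in_piece; lra|].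
  destruct (Hpt (elo M j + l / 2)) as (z2 & Hz2 & Hz2' & E2); [unfold in_piece; lra|].
  specialize (HL z2 z1 Hz2 Hz1). rewrite E1, E2 in HL.
  replace (elo M j + l / 2 - elo M j) with (l / 2) in HL by ring.
  rewrite Rabs_right in HL by lra.
  assert (Rabs (z2 - z1) <= b' - a') by (apply Rabs_le; lra).
  assert (0 < K / (b - a)) by (apply Rdiv_lt_0_compat; lra).
  assert (l / 2 <= K / (b - a) * (b' - a')).
  { eapply Rle_trans; [apply HL|]. apply Rmult_le_compat_l; lra. }
  apply Rmult_le_reg_l with (K / (b - a)); auto.
  replace (K / (b - a) * (l / (2 * K) * (b - a))) with (l / 2) by (field; lra). auto.
Qed.

(** Take the first cylinder about the midpoint that fits into [[u,v)]. Its parent does not fit,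
    hence is at least half as long as [[u,v)], and [dcyl_ratio] passes this on. *)
Lemma interval_subcylinder M : is_expanding_map M -> bounded_distortion M ->
  exists c, 0 < c /\ forall u v, 0 <= u < v -> v <= 1 ->
    exists x n a b, unit_int x /\ (forall z, dcyl M x n z <-> a <= z < b) /\
      u <= a /\ a < b /\ b <= v /\ c * (v - u) <= b - a.
Proof.
  intros HM HB. destruct (dcyl_ratio M HM HB) as (c0 & Hc0 & Hratio).
  exists (Rmin 1 (c0 / 2)). split; [apply Rmin_pos; lra|].
  assert (Hm1 := Rmin_l 1 (c0 / 2)). assert (Hm2 := Rmin_r 1 (c0 / 2)).
  set (c := Rmin 1 (c0 / 2)) in *.
  intros u v Huv Hv. set (x := (u + v) / 2).
  assert (Hx : unit_int x) by (unfold unit_int, x; lra).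
  set (P := fun n => forall z, dcyl M x n z -> u <= z < v).
  destruct (dcyl_shrink M x ((v - u) / 4) HM Hx) as [N HN]; [lra|].
  assert (HP : P N).
  { intros z Hz. assert (H := HN N (Nat.le_refl _) z x Hz (dcyl_refl M x N Hx)).
    apply Rabs_le_inv in H. unfold x in *. lra. }
  destruct (dec_inh_nat_subset_has_unique_least_element P) as (n & [Hn Hmin] & _);
    [intros; apply classic|eauto|].
  destruct (dcyl_interval M x n HM Hx) as (a & b & Hab & Hcyl & _).
  exists x, n, a, b. split; auto. split; auto.
  assert (u <= a) by (apply Hn, Hcyl; lra).
  assert (b <= v).
  { apply Rnot_lt_le; intros Hlt.
    assert (u <= Rmax a v < v) as [_ H'].
    { apply Hn, Hcyl. split; [apply Rmax_l|apply Rmax_lub_lt; lra]. }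
    assert (H2 := Rmax_r a v). lra. }
  split; auto. split; [lra|]. split; auto.
  (* Generation [0] has no parent, but its cylinder is all of [[0,1)]; hence the [1] in the
     constant. *)
  destruct n as [|n].
  - assert (Hz : forall z, unit_int z -> a <= z < b).
    { intros z Hz. apply Hcyl. split; auto. lia. }
    assert (a <= 0 < b) by (apply Hz; unfold unit_int; lra).
    assert (1 <= b).
    { apply Rnot_lt_le; intros Hb. assert (a <= b < b) by (apply Hz; unfold unit_int; lra). lra. }
    assert (0 <= (1 - c) * (v - u)) by (apply Rmult_le_pos; lra). lra.
  - assert (Hnp : ~ P n) by (intros H'; apply Hmin in H'; lia).
    destruct (dcyl_interval M x n HM Hx) as (a1 & b1 & Hab1 & Hcyl1 & _).
    assert ((v - u) / 2 <= b1 - a1).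
    { apply not_all_ex_not in Hnp. destruct Hnp as [z Hz].
      apply imply_to_and in Hz. destruct Hz as [Hz Hout].
      apply Hcyl1 in Hz. assert (Hx1 := proj1 (Hcyl1 x) (dcyl_refl M x n Hx)).
      apply Rnot_lt_le; intros Hlt. apply Hout. unfold x in *. lra. }
    assert (H' := Hratio x n a1 b1 a b Hx Hcyl1 Hcyl).
    assert (c0 / 2 * (v - u) <= c0 * (b1 - a1)).
    { replace (c0 / 2 * (v - u)) with (c0 * ((v - u) / 2)) by field.
      apply Rmult_le_compat_l; lra. }
    assert (c * (v - u) <= c0 / 2 * (v - u)) by (apply Rmult_le_compat_r; lra).
    lra.
Qed.

(** * Digit frequencies *)

Lemma filter_seq_shift (P Q : nat -> bool) n D a :
  (forall k, P (n + k)%nat = Q k) ->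
  length (filter P (seq (n + a) D)) = length (filter Q (seq a D)).
Proof.
  intros H; revert a; induction D as [|D IH]; intros a; simpl; auto.
  rewrite H. specialize (IH (S a)). rewrite Nat.add_succ_r in IH.
  destruct (Q a); simpl; auto.
Qed.

Lemma tau_le M m w x n : (tau M m w x n <= n - m)%nat.
Proof.
  unfold tau. eapply Nat.le_trans; [apply filter_length_le|].
  rewrite length_seq. auto.
Qed.

(** The first [n] starting positions contribute [e]; the remaining ones read the digits of
    [f^n x]. *)
Lemma tau_shift M m w x n N : (m < N)%nat ->
  exists e, (e <= n)%nat /\
    tau M m w x (n + N) = (e + tau M m w (Nat.iter n (ef M) x) N)%nat.
Proof.
  intros Hm. unfold tau.
  replace (n + N - m)%nat with (n + (N - m))%nat by lia.
  rewrite seq_app, filter_app, length_app. eexists. split; cycle 1.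
  - f_equal. rewrite Nat.add_0_l, <- (Nat.add_0_r n) at 1.
    apply filter_seq_shift. intros k.
    replace (block M m (n + k) x) with (block M m k (Nat.iter n (ef M) x)); auto.
    unfold block. apply map_ext. intros j. unfold digit.
    rewrite <- Nat.iter_add. do 2 f_equal. lia.
  - eapply Nat.le_trans; [apply filter_length_le|]. rewrite length_seq. auto.
Qed.

Lemma tau_dcyl M m w x y n : (m <= n)%nat -> dcyl M x n y ->
  tau M m w y n = tau M m w x n.
Proof.
  intros Hm [_ H]. unfold tau. f_equal. apply filter_ext_in. intros k Hk.
  apply in_seq in Hk.
  replace (block M m k y) with (block M m k x); auto.
  unfold block. apply map_ext_in. intros j Hj. apply in_seq in Hj.
  unfold digit at 2. rewrite H; [auto|lia].
Qed.

(** Prefixing [n] digits changes the counts and the number of positions by at most [n], which is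
    negligible in the limit. *)
Lemma freq_set_shift M m p n x : unit_int x ->
  freq_set M m p (Nat.iter n (ef M) x) -> freq_set M m p x.
Proof.
  intros Hx [_ Hacc]. split; auto. intros eps He N.
  (* With [D >= N1] positions, the change [n / D] stays below [eps / 2]. *)
  destruct (INR_unbounded (2 * INR n / eps)) as [N1 HN1].
  destruct (Hacc (eps / 2) ltac:(lra) (N + m + N1)%nat) as (N2 & HN2 & Hm & Hw).
  exists (n + N2)%nat. split; [lia|]. split; [lia|]. intros w Hv.
  specialize (Hw w Hv).
  destruct (tau_shift M m w x n N2 Hm) as (e & Hen & ->).
  assert (Ht := tau_le M m w (Nat.iter n (ef M) x) N2).
  set (tt := tau M m w (Nat.iter n (ef M) x) N2) in *.
  replace (n + N2 - m)%nat with (n + (N2 - m))%nat by lia.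
  assert (HD1 : (N1 <= N2 - m)%nat) by lia.
  assert (HD0 : (0 < N2 - m)%nat) by lia.
  set (D := (N2 - m)%nat) in *. clearbody tt D.
  apply le_INR in Hen, Ht, HD1. apply lt_INR in HD0. simpl INR in HD0.
  rewrite !plus_INR.
  assert (H0n := pos_INR n). assert (H0e := pos_INR e). assert (H0t := pos_INR tt).
  assert (Hdiff : Rabs ((INR e + INR tt) / (INR n + INR D) - INR tt / INR D)
                  <= eps / 2).
  (* The numerator is a difference of two products, each between [0] and [n * D]. *)
  { replace ((INR e + INR tt) / (INR n + INR D) - INR tt / INR D)
      with ((INR e * INR D - INR tt * INR n) / (INR D * (INR n + INR D)))
      by (field; lra).
    assert (0 < INR D * (INR n + INR D)) by (apply Rmult_lt_0_compat; lra).
    assert (INR n <= eps / 2 * INR D).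
    { apply Rmult_lt_compat_r with (r := eps / 2) in HN1; [|lra].
      replace (2 * INR n / eps * (eps / 2)) with (INR n) in HN1 by (field; lra).
      assert (INR N1 * (eps / 2) <= INR D * (eps / 2)) by (apply Rmult_le_compat_r; lra).
      lra. }
    assert (0 <= INR e * INR D <= INR n * INR D)
      by (split; [apply Rmult_le_pos|apply Rmult_le_compat_r]; lra).
    assert (0 <= INR tt * INR n <= INR D * INR n)
      by (split; [apply Rmult_le_pos|apply Rmult_le_compat_r]; lra).
    assert (INR n * INR D <= eps / 2 * (INR D * (INR n + INR D))).
    { apply Rle_trans with (eps / 2 * INR D * INR D).
      - apply Rmult_le_compat_r; lra.
      - rewrite Rmult_assoc. apply Rmult_le_compat_l; [lra|].
        apply Rmult_le_compat_l; lra. }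
    unfold Rdiv at 1. rewrite Rabs_mult, (Rabs_right (/ _)).
    2: { apply Rle_ge, Rlt_le, Rinv_0_lt_compat; auto. }
    apply Rmult_le_reg_r with (INR D * (INR n + INR D)); auto.
    rewrite Rmult_assoc, Rinv_l, Rmult_1_r by lra.
    apply Rabs_le. lra. }
  assert (Htri := Rabs_triang ((INR e + INR tt) / (INR n + INR D) - INR tt / INR D)
                    (INR tt / INR D - p w)).
  replace ((INR e + INR tt) / (INR n + INR D) - INR tt / INR D + (INR tt / INR D - p w))
    with ((INR e + INR tt) / (INR n + INR D) - p w) in Htri by ring.
  lra.
Qed.

(** The interval contains a comparably long cylinder, which [f^n] maps onto [[0,1)]. By
    [freq_set_shift] the images of a cover of the set inside the cylinder cover the whole set, and
    radii grow by at most the factor [L]. *)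
Lemma freq_set_interval_content M m p s :
  is_expanding_map M -> bounded_distortion M -> 0 < s ->
  ~ hausdorff_null s (freq_set M m p) ->
  exists h, 0 < h /\ forall u v, 0 <= u < v -> v <= 1 ->
    exists x n a b, unit_int x /\ (forall z, dcyl M x n z <-> a <= z < b) /\
      u <= a /\ a < b /\ b <= v /\
      content_gt s (fun z => freq_set M m p z /\ a <= z < b) (h * Rpower (v - u) s).
Proof.
  intros HM HB Hs Hn.
  destruct (not_null_content_gt s _ Hs Hn) as (c & Hc & Hcont).
  destruct (interval_subcylinder M HM HB) as (k & Hk & Hsub).
  destruct (iter_lipschitz M HM HB) as (K & HK & HL).
  assert (HkK : 0 < k / K) by (apply Rdiv_lt_0_compat; lra).
  exists (c * Rpower (k / K) s). split; [apply Rmult_lt_0_compat; auto; apply Rpower_pos|].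
  intros u v Huv Hv.
  destruct (Hsub u v Huv Hv) as (x & n & a & b & Hx & Hcyl & Ha & Hab & Hb & Hlen).
  exists x, n, a, b. repeat (split; auto).
  intros T code Hinj V rho HV Hcov.
  set (L := K / (b - a)). assert (HL0 : 0 < L) by (apply Rdiv_lt_0_compat; lra).
  destruct (Hcont T code Hinj
    (fun i y => exists z, V i z /\ a <= z < b /\ Nat.iter n (ef M) z = y)
    (fun i => L * rho i)) as (l & Hl & Hsum).
  - intros i. destruct (HV i) as [H0 Hd]. split; [apply Rmult_le_pos; lra|].
    intros y1 y2 (z1 & V1 & I1 & <-) (z2 & V2 & I2 & <-).
    eapply Rle_trans.
    + apply (HL (fun j => digit M j x) n a b); auto. intros; apply digit_lt; auto.
    + apply Rmult_le_compat_l; [lra|]. auto.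
  - intros y Hy. destruct (dcyl_interval M x n HM Hx) as (a1 & b1 & _ & H1 & Honto).
    destruct (Honto y (proj1 Hy)) as (z & Hz & E). apply H1 in Hz.
    destruct (Hcov z) as [i Hi].
    + split; [|apply Hcyl; auto]. apply freq_set_shift with n; [apply Hz|].
      rewrite E; auto.
    + exists i, z. split; auto. split; [apply Hcyl; auto|auto].
  - exists l. split; auto.
    assert (E : lsum (fun i => pw (L * rho i) s) l =
            Rpower L s * lsum (fun i => pw (rho i) s) l).
    { rewrite <- lsum_scal. clear - HL0.
      induction l as [|i l IH]; simpl; auto. rewrite IH, pw_scale by auto. auto. }
    rewrite E in Hsum.
    assert (HLs := Rpower_pos L s).
    apply Rmult_lt_reg_l with (Rpower L s); auto.
    eapply Rle_lt_trans; [|apply Hsum].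
    (* This is [k * (v - u) <= b - a], rewritten in terms of [L] and raised to the power [s]. *)
    assert (Hle : Rpower L s * (Rpower (k / K) s * Rpower (v - u) s) <= 1).
    { assert (0 < k / K * (v - u)) by (apply Rmult_lt_0_compat; lra).
      rewrite !Rpower_mult_distr by lra.
      rewrite <- (Rpower_1_l s). apply Rpower_le_compat; [lra|].
      split; [apply Rmult_lt_0_compat; lra|].
      apply Rmult_le_reg_l with (b - a); [lra|].
      unfold L. replace ((b - a) * (K / (b - a) * (k / K * (v - u))))
        with (k * (v - u)) by (field; lra). lra. }
    apply Rmult_le_compat_l with (r := c) in Hle; lra.
Qed.

(** * The intersection *)

(** Lets words serve as natural-number indices of intervals. The successor keeps the empty word
    apart. *)
Fixpoint list_code (l : list nat) : nat :=
  match l with [] => 0%nat | a :: l => S (Cantor.to_nat (a, list_code l)) end.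

Lemma list_code_inj l l' : list_code l = list_code l' -> l = l'.
Proof.
  revert l'; induction l as [|a l IH]; intros [|a' l'] H; try discriminate; auto.
  apply Nat.succ_inj, Cantor.to_nat_inj in H. injection H as -> H. f_equal; auto.
Qed.

Lemma interval_ext a b a' b' : a < b -> a' < b' ->
  (forall z, a <= z < b <-> a' <= z < b') -> a = a' /\ b = b'.
Proof.
  intros Hab Hab' H.
  assert (a = a').
  { assert (H1 := proj1 (H a)). assert (H2 := proj2 (H a')). lra. }
  subst a'. split; auto.
  destruct (Rtotal_order b b') as [Hlt|[|Hlt]]; auto.
  - assert (H1 := proj2 (H b)). lra.
  - assert (H1 := proj1 (H b')). lra.
Qed.

(** One index [j] controls both the precision and the least length, which turns accumulation at [p]
    into a countable conjunction. *)
Definition freq_close (M : emap) (m : nat) (p : list nat -> R) (j n : nat) (x : R) : Prop :=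
  (j <= n)%nat /\ (m < n)%nat /\
  forall w, valid_word (eg M) m w ->
    Rabs (INR (tau M m w x n) / INR (n - m) - p w) < / INR (S j).

Lemma inv_INR_S_pos j : 0 < / INR (S j).
Proof. apply Rinv_0_lt_compat, lt_0_INR. lia. Qed.

Lemma freq_set_iff M m p x : unit_int x ->
  (freq_set M m p x <-> forall j, exists n, freq_close M m p j n x).
Proof.
  intros Hx. split.
  - intros [_ H] j. destruct (H _ (inv_INR_S_pos j) j) as (n & H1 & H2 & H3).
    exists n. repeat split; auto.
  - intros H. split; auto. intros eps He N.
    destruct (INR_unbounded (/ eps)) as [N1 HN1].
    destruct (H (N + N1)%nat) as (n & H1 & H2 & H3).
    exists n. split; [lia|]. split; auto. intros w Hw.
    eapply Rlt_le_trans; [apply (H3 w Hw)|].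
    assert (0 < / eps) by (apply Rinv_0_lt_compat; auto).
    rewrite <- (Rinv_inv eps). apply Rinv_le_contravar; auto.
    apply Rle_trans with (INR N1); [lra|]. apply le_INR. lia.
Qed.

Lemma freq_close_dcyl M m p j n x y :
  dcyl M x n y -> freq_close M m p j n x -> freq_close M m p j n y.
Proof.
  intros H (H1 & H2 & H3). repeat split; auto. intros w Hw.
  rewrite (tau_dcyl M m w x y n); auto. lia.
Qed.

Lemma exists_small_factor A B e : 0 < A -> 0 < B -> 0 < e ->
  exists d, 0 < d /\ Rpower d e * B <= A.
Proof.
  intros HA HB He. exists (Rpower (A / B) (/ e)). split; [apply Rpower_pos|].
  rewrite Rpower_root; auto; [|apply Rdiv_lt_0_compat; auto].
  apply Req_le. field. lra.
Qed.

(** Each point of the set is stopped at the first sufficiently deep generation whose cylinder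
    settles condition [j] and is short. Stopping cylinders are equal or disjoint, so
    [light_interval] applies. The factor [q] is fixed before [c2], because [c2] will come from the
    map of the next stage. *)
Lemma freq_set_light_subinterval M m p s t :
  is_expanding_map M -> bounded_distortion M -> 0 < t < s ->
  ~ hausdorff_null s (freq_set M m p) ->
  exists q, 0 < q <= 1 /\
  forall U r, (forall k, 0 < r k /\ diam_le (U k) (r k)) ->
  forall u v, 0 <= u < v -> v <= 1 ->
  weight_le U r t u v (Rpower (q * (v - u)) t) ->
  forall c2 j, 0 < c2 ->
  exists u' v', u <= u' < v' /\ v' <= (u + v) / 2 /\
    weight_le U r t u' v' (c2 * Rpower (v' - u') t) /\
    forall x, u' <= x < v' -> exists n, freq_close M m p j n x.
Proof.
  intros HM HB Hts Hnull.
  destruct (freq_set_interval_content M m p s HM HB) as (h & Hh & Hcont); [lra|auto|].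
  (* Since [3 * (q * L) = 6 * q * (L / 2)], this [q0] keeps the first cost in [light_interval]
     within half of the content [c]. *)
  destruct (exists_small_factor (h / 2) (Rpower 6 s) s) as (q0 & Hq0 & Hq0h);
    [lra|apply Rpower_pos|lra|].
  exists (Rmin 1 q0).
  assert (Hq : 0 < Rmin 1 q0) by (apply Rmin_pos; lra).
  assert (Hq1 := Rmin_l 1 q0). assert (Hq2 := Rmin_r 1 q0).
  set (q := Rmin 1 q0) in *. split; [lra|].
  intros U r HU u v Huv Hv Hw c2 j Hc2.
  set (L := v - u) in *.
  (* Working in the left half makes the new interval end by the midpoint, as the limit argument
     requires. *)
  destruct (Hcont u ((u + v) / 2)) as (x0 & n0 & a & b & Hx0 & Hcyl0 & Ha & Hab & Hb & HX);
    [lra|lra|].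
  replace ((u + v) / 2 - u) with (L / 2) in HX by (unfold L; field).
  set (X := fun z => freq_set M m p z /\ a <= z < b) in *.
  set (c := h * Rpower (L / 2) s) in *.
  assert (HL : 0 < L) by (unfold L; lra).
  assert (Hc : 0 < c) by (apply Rmult_lt_0_compat; auto; apply Rpower_pos).
  (* A small [delta] absorbs [2 / c2], so the second cost also takes at most half of [c]. *)
  destruct (exists_small_factor (c / 2) (2 / c2 * Rpower (q * L) t) (s - t))
    as (delta & Hdelta & Hdc).
  { lra. } { apply Rmult_lt_0_compat; [apply Rdiv_lt_0_compat; lra|apply Rpower_pos]. }
  { lra. }
  set (Good := fun n z => (n0 <= n)%nat /\ freq_close M m p j n z /\
                          diam_le (dcyl M z n) delta).
  (* Goodness at [n] depends on the first [n] digits only. *)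
  assert (Htrans : forall n y z, dcyl M z n y -> Good n z -> Good n y).
  { intros n y z H (H1 & H2 & H3). split; auto. split; [eapply freq_close_dcyl; eauto|].
    intros v1 v2 Hv1 Hv2. apply H3; apply (dcyl_eq M z y n H); auto. }
  assert (Hstop : forall z, exists d : nat * (R * R), X z ->
    Good (fst d) z /\ (forall k, (k < fst d)%nat -> ~ Good k z) /\
    forall y, dcyl M z (fst d) y <-> fst (snd d) <= y < snd (snd d)).
  { intros z. destruct (classic (X z)) as [Hz|]; [|exists (0%nat, (0, 0)); tauto].
    destruct Hz as [Hz Hzab]. assert (Hzu := proj1 Hz).
    destruct (dcyl_shrink M z delta HM Hzu Hdelta) as [N HN].
    assert (HG : exists n, Good n z).
    (* The index [n0 + N + j] enforces depth [n0], a short cylinder and precision [j] at once. *)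
    { destruct (proj1 (freq_set_iff M m p z Hzu) Hz (n0 + N + j)%nat) as (n & H1 & H2 & H3).
      exists n. split; [lia|]. split; [|apply HN; lia].
      split; [lia|]. split; auto. intros w Hwv.
      eapply Rlt_le_trans; [apply H3; auto|].
      apply Rinv_le_contravar; [apply lt_0_INR; lia|apply le_INR; lia]. }
    destruct (dec_inh_nat_subset_has_unique_least_element (fun n => Good n z))
      as (n & [Hn Hmin] & _); [intros; apply classic|auto|].
    destruct (dcyl_interval M z n HM Hzu) as (al & be & _ & Hcyl & _).
    exists (n, (al, be)). intros _. simpl. split; auto. split; auto.
    intros k Hk Hgk. apply Hmin in Hgk. lia. }
  apply functional_choice in Hstop. destruct Hstop as [d Hd].
  set (nn := fun z => fst (d z)) in *.
  set (al := fun z => fst (snd (d z))) in *. set (be := fun z => snd (snd (d z))) in *.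
  assert (HdX : forall z, X z -> Good (nn z) z /\
    (forall k, (k < nn z)%nat -> ~ Good k z) /\
    forall y, dcyl M z (nn z) y <-> al z <= y < be z) by exact Hd.
  assert (Hself : forall z, X z -> al z <= z < be z).
  { intros z Hz. destruct (HdX z Hz) as (_ & _ & H).
    apply H, dcyl_refl. apply Hz. }
  assert (Hsub : forall z, X z -> a <= al z /\ be z <= b).
  { intros z Hz. assert (H1 := Hself z Hz).
    assert (H : forall y, al z <= y < be z -> a <= y < b).
    { intros y Hy. destruct (HdX z Hz) as ((Hn & _) & _ & H).
      apply Hcyl0. apply (dcyl_eq M x0 z n0); [apply Hcyl0, Hz|].
      apply dcyl_mono with (nn z); auto. apply H; auto. }
    split; [apply H; lra|]. apply Rnot_lt_le; intros Hlt.
    assert (H' : a <= Rmax b (al z) < b)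
      by (apply H; split; [apply Rmax_r|apply Rmax_lub_lt; lra]).
    assert (H2 := Rmax_l b (al z)). lra. }
  destruct (light_interval U r t s a b (q * L) c2 delta c X al be
              (fun z => list_code (block M (nn z) 0 z))) as (z & Hz & Hlight); auto.
  - apply Rmult_lt_0_compat; lra.
  - eapply weight_le_mono; [| | |apply Hw]; lra.
  - intros z Hz. assert (H1 := Hself z Hz).
    destruct (Hsub z Hz) as [H2 H3].
    repeat split; try lra.
    destruct (HdX z Hz) as ((_ & _ & Hdiam) & _ & H).
    (* The right end is not in the cylinder, so the diameter bounds the length only up to [e]. *)
    apply Rle_plus_epsilon. intros e He.
    set (y := Rmax (al z) (be z - e)).
    assert (al z <= y) by apply Rmax_l. assert (be z - e <= y) by apply Rmax_r.
    assert (y < be z) by (apply Rmax_lub_lt; lra).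
    assert (H' : Rabs (y - al z) <= delta) by (apply Hdiam; apply H; lra).
    apply Rabs_le_inv in H'. lra.
  - intros y z Hy Hz E. apply list_code_inj in E. unfold block in E.
    assert (En : nn y = nn z).
    { apply (f_equal (@length nat)) in E. now rewrite !length_map, !length_seq in E. }
    destruct (HdX y Hy) as (_ & _ & H1), (HdX z Hz) as (_ & _ & H2).
    assert (H3 := Hself y Hy). assert (H4 := Hself z Hz).
    apply interval_ext; try lra.
    intros v0. rewrite <- H1, <- H2, <- En. rewrite <- En in E.
    apply dcyl_eq. split; [apply Hy|]. intros k Hk.
    apply map_ext_in_iff with (a := k) in E; [exact E|].
    apply in_seq. lia.
  - intros y z Hy Hz Hne.
    assert (H3 := Hself y Hy). assert (H4 := Hself z Hz).
    apply NNPP; intros Hov. apply Hne.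
    destruct (HdX y Hy) as (Gy & My & H1), (HdX z Hz) as (Gz & Mz & H2).
    assert (Hv' : exists v0, al y <= v0 < be y /\ al z <= v0 < be z).
    { exists (Rmax (al y) (al z)).
      assert (Rmax (al y) (al z) < Rmin (be y) (be z)).
      { apply Rmin_glb_lt; apply Rmax_lub_lt; lra. }
      assert (H5 := Rmin_l (be y) (be z)). assert (H6 := Rmin_r (be y) (be z)).
      assert (H7 := Rmax_l (al y) (al z)). assert (H8 := Rmax_r (al y) (al z)). lra. }
    destruct Hv' as (v0 & Hv1 & Hv2). apply H1 in Hv1. apply H2 in Hv2.
    (* If [y] were stopped earlier, goodness would pass through the common point [v0] to [z],
       against the minimality of [nn z]. By symmetry the generations agree, and [v0] then shows that
       the words do. *)
    assert (Hle : forall y z, X y -> Good (nn y) y -> (forall k, (k < nn z)%nat -> ~ Good k z) ->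
              dcyl M y (nn y) v0 -> dcyl M z (nn z) v0 -> X z -> (nn z <= nn y)%nat).
    { clear - Htrans. intros y z Hy Gy Mz Hv1 Hv2 Hz.
      apply Nat.nlt_ge. intros Hlt. apply (Mz (nn y)); auto.
      apply (Htrans _ z v0).
      - apply (dcyl_eq M z v0 (nn y)); [apply dcyl_mono with (nn z); auto; lia|].
        apply dcyl_refl, Hz.
      - apply (Htrans _ v0 y); auto. }
    assert (En : nn y = nn z) by (apply Nat.le_antisymm; eapply Hle; eauto).
    f_equal. rewrite En in *. unfold block. apply map_ext_in. intros k Hk.
    apply in_seq in Hk. destruct Hv1 as [_ E1], Hv2 as [_ E2].
    specialize (E1 k). specialize (E2 k). simpl. rewrite <- E1, <- E2; auto; lia.
  - assert (Rpower (3 * (q * L)) s <= c / 2).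
    { replace (3 * (q * L)) with (q * 6 * (L / 2)) by field.
      rewrite <- !Rpower_mult_distr by lra. unfold c.
      replace (h * Rpower (L / 2) s / 2) with (h / 2 * Rpower (L / 2) s) by field.
      apply Rmult_le_compat_r; [apply Rlt_le, Rpower_pos|].
      eapply Rle_trans; [|apply Hq0h].
      apply Rmult_le_compat_r; [apply Rlt_le, Rpower_pos|].
      apply Rpower_le_compat; lra. }
    lra.
  - exists (al z), (be z). assert (H1 := Hself z Hz).
    destruct (Hsub z Hz) as [H2 H3].
    split; [lra|]. split; [lra|]. split; auto.
    intros y Hy. exists (nn z). destruct (HdX z Hz) as ((_ & H' & _) & _ & H).
    apply freq_close_dcyl with z; auto. apply H; auto.
Qed.

Lemma dependent_choice_nat {A : Type} (P : nat -> A -> Prop) (Q : nat -> A -> A -> Prop) a0 :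
  P 0%nat a0 -> (forall n a, P n a -> exists a', P (S n) a' /\ Q n a a') ->
  exists f : nat -> A, f 0%nat = a0 /\ forall n, P n (f n) /\ Q n (f n) (f (S n)).
Proof.
  intros H0 Hs.
  assert (H : forall na : nat * A, exists a', P (fst na) (snd na) ->
            P (S (fst na)) a' /\ Q (fst na) (snd na) a').
  { intros [n a]. destruct (classic (P n a)) as [H|]; [|exists a0; tauto].
    destruct (Hs n a H) as [a' H']. exists a'. auto. }
  apply functional_choice in H. destruct H as [next Hnext].
  set (f := fix f n := match n with O => a0 | S n => next (n, f n) end).
  assert (HP : forall n, P n (f n)).
  { intros n; induction n as [|n IH]; simpl; auto. apply (Hnext (n, f n)); auto. }
  exists f. split; auto. intros n. split; auto. apply (Hnext (n, f n)), HP.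
Qed.

(** Half-open intervals with a common right end may have no common point. Ending by the midpoint
    keeps the supremum of the left ends below every [b n]. *)
Lemma nested_halving_limit (a b : nat -> R) :
  (forall n, a n <= a (S n) < b (S n) /\ b (S n) <= (a n + b n) / 2) ->
  exists x, forall n, a n <= x < b n.
Proof.
  intros H.
  assert (Ha : forall n k, a n <= a (n + k)%nat).
  { intros n k; induction k as [|k IH]; [rewrite Nat.add_0_r; lra|].
    rewrite Nat.add_succ_r. specialize (H (n + k)%nat). lra. }
  assert (Hb : forall n k, b (S n + k)%nat <= b (S n)).
  { intros n k; induction k as [|k IH]; [rewrite Nat.add_0_r; lra|].
    rewrite Nat.add_succ_r. assert (H1 := H (S n + k)%nat).
    assert (H2 := H (n + k)%nat). simpl in *. lra. }
  assert (Hab : forall n k, a k <= b (S n)).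
  { intros n k. assert (H1 := Ha k (S n)). assert (H2 := Hb n k).
    assert (H3 := H (n + k)%nat). rewrite Nat.add_comm in H1. simpl in *. lra. }
  destruct (completeness (fun y => exists n, y = a n)) as [x [Hub Hlub]].
  - exists (b 1%nat). intros y [n ->]. apply Hab.
  - exists (a 0%nat). eauto.
  - exists x. intros n. split; [apply Hub; eauto|].
    assert (x <= b (S n)) by (apply Hlub; intros y [k ->]; apply Hab).
    specialize (H n). lra.
Qed.

Lemma iInter_freq_set_not_null (F : nat -> emap) (m : nat -> nat) (p : nat -> list nat -> R)
  (s t : R) :
  (forall i, is_expanding_map (F i)) -> (forall i, bounded_distortion (F i)) ->
  0 < t < s -> (forall i, ~ hausdorff_null s (freq_set (F i) (m i) (p i))) ->
  ~ hausdorff_null t (fun x => forall i, freq_set (F i) (m i) (p i) x).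
Proof.
  intros HF HB Hts Hn Hnull.
  assert (Hstep := fun i => freq_set_light_subinterval (F i) (m i) (p i) s t
                              (HF i) (HB i) Hts (Hn i)).
  apply functional_choice in Hstep. destruct Hstep as [q Hq].
  (* Stage [k] serves the map [fst (of_nat k)] at precision [snd (of_nat k)]. *)
  set (Q := fun k => q (fst (Cantor.of_nat k))).
  assert (HQ : forall k, 0 < Q k <= 1) by (intros; apply Hq).
  (* The total cost is chosen so that [[0,1)] is as light as stage [0] demands. *)
  destruct (Hnull (Rpower (Q 0%nat) t) 1) as (U & r & HUr & Hcov & Hsum);
    [apply Rpower_pos|lra|].
  assert (HU : forall k, 0 < r k /\ diam_le (U k) (r k))
    by (intros k; destruct (HUr k); tauto).
  destruct (dependent_choice_nat
    (fun k (I : R * R) => (0 <= fst I < snd I /\ snd I <= 1) /\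
       weight_le U r t (fst I) (snd I) (Rpower (Q k * (snd I - fst I)) t))
    (fun k I I' => (fst I <= fst I' < snd I' /\ snd I' <= (fst I + snd I) / 2) /\
       forall x, fst I' <= x < snd I' -> let i := fst (Cantor.of_nat k) in
         exists n, freq_close (F i) (m i) (p i) (snd (Cantor.of_nat k)) n x)
    (0, 1)) as (I & HI0 & HI).
  - simpl. split; [lra|]. rewrite Rminus_0_r, Rmult_1_r. intros N.
    apply Rle_trans with (sum_f_R0 (fun k => Rpower (r k) t) N); auto.
    rewrite lsum_seq. apply Rle_trans with (lsum (hit_mass U r t 0 1) (seq 0 (S N))).
    + apply lsum_seq_mono; auto. apply hit_mass_nonneg.
    + apply lsum_le. intros k _. unfold hit_mass.
      destruct excluded_middle_informative; [lra|apply Rlt_le, Rpower_pos].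
  - intros k [u v] [Huv Hw]. simpl in *.
    destruct (Hq (fst (Cantor.of_nat k))) as [_ H].
    (* Taking [Q (S k)^t] for [c2] produces exactly the weight bound of the next stage. *)
    destruct (H U r HU u v (proj1 Huv) (proj2 Huv) Hw (Rpower (Q (S k)) t)
                (snd (Cantor.of_nat k)) (Rpower_pos _ _))
      as (u' & v' & H1 & H2 & H3 & H4).
    exists (u', v'). simpl. split; [split; [lra|]|split; auto].
    rewrite Rpower_mult_distr in H3; auto; [apply HQ|lra].
  - destruct (nested_halving_limit (fun k => fst (I k)) (fun k => snd (I k)))
      as [x Hx]; [intros k; apply HI|].
    assert (Hux : unit_int x).
    { assert (H := Hx 0%nat). rewrite HI0 in H. exact H. }
    destruct (Hcov x) as [k Hk].
    { intros i. apply freq_set_iff; auto. intros j.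
      destruct (HI (Cantor.to_nat (i, j))) as (_ & _ & H).
      rewrite Cantor.cancel_of_to in H. apply H. apply (Hx (S (Cantor.to_nat (i, j)))). }
    assert (Hlen : forall n, 0 < snd (I n) - fst (I n) <= (/ 2) ^ n).
    { intros n. split; [specialize (Hx n); lra|].
      induction n as [|n IH]; [rewrite HI0; simpl; lra|].
      destruct (HI n) as (_ & H & _). simpl. lra. }
    destruct (pow_lt_1_zero (/ 2)) with (y := r k) as [N HN].
    { rewrite Rabs_right; lra. } { apply HU. }
    specialize (HN N (Nat.le_refl _)). specialize (Hlen N).
    apply Rabs_def2 in HN.
    (* [U k] contains [x] and so meets the interval of stage [N], whose weight forces [r k] to be at
       most its length; but [N] makes this length less than [r k]. *)
    assert (r k <= Q N * (snd (I N) - fst (I N))).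
    { apply (weight_radius U r t (fst (I N)) (snd (I N))); [lra| |apply HI|exists x; auto].
      apply Rmult_lt_0_compat; [apply HQ|lra]. }
    assert (Q N * (snd (I N) - fst (I N)) <= 1 * (snd (I N) - fst (I N))).
    { apply Rmult_le_compat_r; [lra|apply HQ]. }
    lra.
Qed.

(** * The dimension formula *)

Lemma hausdorff_null_subset s (E E' : R -> Prop) :
  (forall x, E x -> E' x) -> hausdorff_null s E' -> hausdorff_null s E.
Proof.
  intros H HE eps delta He Hd. destruct (HE eps delta He Hd) as (U & r & H1 & H2 & H3).
  exists U, r. auto.
Qed.

(* Every cover in [hausdorff_null] is infinite with positive radii. *)
Lemma not_hausdorff_null_0 E : ~ hausdorff_null 0 E.
Proof.
  intros H. destruct (H (/ 2) 1) as (U & r & H1 & _ & H3); [lra|lra|].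
  specialize (H3 0%nat). simpl in H3. rewrite Rpower_O in H3; [lra|apply H1].
Qed.

Theorem mainTheorem3
  (F : nat -> emap) (m : nat -> nat) (p : nat -> list nat -> R)
  (HF : forall i, is_expanding_map (F i))
  (Hi : forall i, bounded_distortion (F i))
  (Hm : forall i, (1 <= m i)%nat)
  (Hp : forall i w, valid_word (eg (F i)) (m i) w -> 0 <= p i w <= 1)
  (d : R) (ds : nat -> R)
  (Hd : is_hausdorff_dim (fun x => forall i, freq_set (F i) (m i) (p i) x) d)
  (Hds : forall i, is_hausdorff_dim (freq_set (F i) (m i) (p i)) (ds i)) :
  is_glb (fun y => exists i, y = ds i) d.
Proof.
  split.
  - intros y [i ->]. apply (proj2 (Hds i)). intros s [Hs0 Hs].
    apply (proj1 Hd). split; auto.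
    eapply hausdorff_null_subset; [|apply Hs]. auto.
  - intros m' Hm'. apply (proj2 Hd). intros t [Ht0 Ht].
    apply Rnot_lt_le. intros Hlt.
    destruct Ht0 as [Ht0|<-]; [|exact (not_hausdorff_null_0 _ Ht)].
    (* The exponent [(t + m') / 2] lies above [t] but below every [ds i], so no single set is null
       at it. *)
    apply (iInter_freq_set_not_null F m p ((t + m') / 2) t); auto; [lra|].
    intros i Hs.
    assert (m' <= ds i) by (apply Hm'; eauto).
    assert (ds i <= (t + m') / 2) by (apply (proj1 (Hds i)); split; auto; lra).
    lra.
Qed.
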